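(* If $P$ is a separative poset, then the map $\omega\colon P\to \mathsf{O}P$ given by $x\mapsto \mathsf{O}(x)$ is a fusion-completion of $P$.
   Context: In a poset $P$, two elements $x,y$ overlap, written $x\circ y$, if there is $z\in P$ with $z\le x$ and $z\le y$; they are disjoint, written $x\wr y$, if they do not overlap. A poset $P$ is separative if whenever $x\not\le y$ there is $z\le x$ with $z\wr y$. A map $f\colon P\to M$ of posets is an order-embedding if $x\le y\iff f(x)\le f(y)$. For $x\in P$ let $\mathsf{O}(x)=\{y\in P\mid x\circ y\}$, and for $A\subseteq P$ let $\mathsf{O}(A)=\bigcup\{\mathsf{O}(x)\mid x\in A\}$. Let $\mathsf{O}P=\{\mathsf{O}(A)\mid \varnothing\neq A\subseteq P\}$, ordered by inclusion. For $\varnothing\ne A\subseteq P$, an element $x\in P$ is a fusion of $A$ if for every $y\in P$: $y\circ x$ if and only if $y\circ z$ for some $z\in A$. A poset is fusion-complete if every nonempty subset has a fusion. A map $f\colon P\to M$ is: $\circ$-reflecting if $f(x)\circ f(y)$ implies $x\circ y$; fusion-preserving if $f(x)$ is a fusion of $f(A)$ in $M$ whenever $x\in P$ is a fusion of $A\subseteq P$; fusion-dense if for every $m\in M$ there is $A\subseteq P$ such that $m$ is a fusion of $f(A)$ in $M$. A fusion-completion of $P$ is a fusion-complete poset $M$ together with a $\circ$-reflecting, fusion-preserving and fusion-dense order-embedding $e\colon P\to M$. *)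

(* Defs.v *)
From HB Require Import structures.
From mathcomp Require Import all_boot all_order.
From mathcomp Require Import boolp classical_sets.

Set Implicit Arguments.
Unset Strict Implicit.
Unset Printing Implicit Defensive.

Import Order.TTheory.

Local Open Scope classical_set_scope.
Local Open Scope order_scope.

(* A poset is a [porderType]. Its decidable order and choice operator cost no
   generality: [boolp] provides both classically for any partial order. *)

Section Overlap.
Context {d : Order.disp_t} {P : porderType d}.
Implicit Types (x y : P) (A : set P).

Definition overlap x y : Prop := exists z, z <= x /\ z <= y.

Definition disj x y : Prop := ~ overlap x y.

Definition overlapping x : set P := [set y | overlap x y].

Definition overlapping_set A : set P := \bigcup_(x in A) overlapping x.

(* Fusions are only defined for nonempty sets, so nonemptiness is part of the
   predicate. *)
Definition is_fusion A x : Prop :=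
  A !=set0 /\ forall y, overlap y x <-> exists2 z, A z & overlap y z.

End Overlap.

Definition separative {d : Order.disp_t} (P : porderType d) : Prop :=
  forall x y : P, ~~ (x <= y) -> exists2 z, z <= x & disj z y.

Definition fusion_complete {d : Order.disp_t} (P : porderType d) : Prop :=
  forall A : set P, A !=set0 -> exists x, is_fusion A x.

Section Maps.
Context {d d' : Order.disp_t} {P : porderType d} {M : porderType d'}.
Implicit Type f : P -> M.

Definition order_embedding f : Prop :=
  forall x y, x <= y <-> f x <= f y.

Definition overlap_reflecting f : Prop :=
  forall x y, overlap (f x) (f y) -> overlap x y.

Definition fusion_preserving f : Prop :=
  forall (A : set P) x, is_fusion A x -> is_fusion (f @` A) (f x).

Definition fusion_dense f : Prop :=
  forall m, exists A : set P, is_fusion (f @` A) m.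

Definition fusion_completion f : Prop :=
  [/\ fusion_complete M, order_embedding f, overlap_reflecting f,
      fusion_preserving f & fusion_dense f].

End Maps.

Section OP.
Context {d : Order.disp_t} (P : porderType d).

Definition OP_set : set (set P) :=
  [set overlapping_set A | A in [set A : set P | A !=set0]].

Record OP : Type := MkOP { OP_val : set P; OP_valP : OP_val \in OP_set }.

(* The order inherited from [set P] is inclusion, see [OP_leP]. *)
HB.instance Definition _ := [isSub for OP_val].
HB.instance Definition _ := [Choice of OP by <:].
HB.instance Definition _ :=
  [SubChoice_isSubPOrder of OP by <: with set_display].

Lemma OP_leP (U V : OP) : U <= V <-> OP_val U `<=` OP_val V.
Proof. by rewrite -Order.le_val /= -subsetEset. Qed.

Lemma overlapping_OP (x : P) : overlapping x \in OP_set.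
Proof.
by apply/mem_set; exists [set x]; [exists x | exact: bigcup_set1].
Qed.

Definition omega (x : P) : OP := MkOP (overlapping_OP x).

End OP.

Arguments OP_set {d} P _.

(* Main.v *)
Require Import Defs.
From mathcomp Require Import all_boot all_order.
From mathcomp Require Import boolp classical_sets.

(** Everything rests on one computation in [OP P]: if [U] is the set of
elements overlapping some member of [A], then [V] overlaps [U] in [OP P] if
and only if [V] contains some member of [A] ([overlap_OP]). For [A] a singleton
this says that [V] overlaps [omega x] exactly when [x] belongs to [V]
([overlap_omega]), hence that [omega] reflects overlap. The two together say
that [V] overlaps [U] if and only if [V] overlaps [omega a] for some [a] in
[A], that is, [U] is a fusion of [omega @` A] when [A] is nonempty
([overlapping_set_is_fusion]).

Every member of [OP P] is of this form, so [omega] is fusion-dense; and since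
[overlapping x = overlapping_set A] whenever [x] is a fusion of [A], [omega]
preserves fusions. A nonempty family [F] in [OP P] has as fusion
[overlapping_set A], where [A] collects the [a] such that [omega a] lies below
some member of [F]. Separativity serves only to make [omega] reflect the
order. *)

Import Order.TTheory.

Local Open Scope classical_set_scope.
Local Open Scope order_scope.

Section OverlapTheory.
Context {d : Order.disp_t} {P : porderType d}.
Implicit Types (x y z : P) (A : set P).

Lemma overlap_refl x : overlap x x.
Proof. by exists x. Qed.

Lemma overlap_sym x y : overlap x y -> overlap y x.
Proof. by move=> [z [zx zy]]; exists z. Qed.

Lemma overlap_le x y z : y <= z -> overlap x y -> overlap x z.
Proof. by move=> yz [w [wx wy]]; exists w; split=> //; exact: le_trans yz. Qed.

Lemma is_fusion_overlapping A x :
  is_fusion A x -> overlapping x = overlapping_set A.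
Proof.
move=> [_ fusAx]; apply/seteqP; split=> y /=.
  by move=> /overlap_sym/fusAx[z Az /overlap_sym zy]; exists z.
by move=> [z Az /overlap_sym yz]; apply/overlap_sym/fusAx; exists z.
Qed.

End OverlapTheory.

Section Omega.
Context {d : Order.disp_t} {P : porderType d}.
Implicit Types (x y : P) (A : set P) (U V W : OP P).

Lemma OP_ex U : exists2 A : set P, A !=set0 & OP_val U = overlapping_set A.
Proof. by have /set_mem[A A0 <-] := OP_valP U; exists A. Qed.

Lemma omega_homo x y : x <= y -> omega x <= omega y.
Proof.
move=> xy; apply/OP_leP => z /= /overlap_sym zx.
exact/overlap_sym/(overlap_le _ _ _ xy).
Qed.

Lemma omega_le_overlapping_set A U x :
  OP_val U = overlapping_set A -> A x -> omega x <= U.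
Proof. by move=> UA Ax; apply/OP_leP; rewrite UA => y xy; exists x. Qed.

(** A lower bound [W] of [U] and [V] contains some [c] with
[overlapping c `<=` W]; this [c] overlaps some [a] in [A], so a common lower
bound of [c] and [a] lies in [V], and then so does [a]. *)
Lemma overlap_OP A U V : OP_val U = overlapping_set A ->
  overlap V U <-> exists2 a, A a & OP_val V a.
Proof.
move=> UA; have [B _ VB] := OP_ex V; split.
  move=> [W [/OP_leP WV /OP_leP WU]].
  have [C [c Cc] WC] := OP_ex W; rewrite UA WC in WU; rewrite VB WC in WV.
  have [|a Aa [z [za zc]]] := WU c; first by exists c => //; exact: overlap_refl.
  have [|b Bb bz] := WV z; first by exists c => //; exists z.
  by exists a => //; rewrite VB; exists b => //; exact: overlap_le za bz.
move=> [a Aa]; rewrite VB => -[b Bb [w [wb wa]]]; exists (omega w); split.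
  exact: le_trans (omega_homo _ _ wb) (omega_le_overlapping_set _ _ _ VB Bb).
exact: le_trans (omega_homo _ _ wa) (omega_le_overlapping_set _ _ _ UA Aa).
Qed.

Lemma overlap_omega V x : overlap V (omega x) <-> OP_val V x.
Proof.
rewrite (overlap_OP [set x]); last by rewrite /overlapping_set bigcup_set1.
by split=> [[_ ->]|Vx] //; exists x.
Qed.

Lemma overlap_overlapping_set A U V : OP_val U = overlapping_set A ->
  overlap V U <-> exists2 a, A a & overlap V (omega a).
Proof.
move=> /overlap_OP ->.
by split=> -[a Aa /overlap_omega Va]; exists a.
Qed.

Lemma overlapping_set_is_fusion A U : A !=set0 ->
  OP_val U = overlapping_set A -> is_fusion (@omega d P @` A) U.
Proof.
move=> [a Aa] UA; split=> [|V]; first by exists (omega a); exists a.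
rewrite (overlap_overlapping_set _ _ _ UA); split.
  by move=> [b Ab Vb]; exists (omega b) => //; exists b.
by move=> [_ [b Ab <-] Vb]; exists b.
Qed.

Lemma omega_fusion_dense : fusion_dense (@omega d P).
Proof.
move=> U; have [A A0 UA] := OP_ex U.
by exists A; exact: overlapping_set_is_fusion.
Qed.

Lemma omega_fusion_preserving : fusion_preserving (@omega d P).
Proof.
move=> A x fusAx; apply: overlapping_set_is_fusion; first by case: fusAx.
exact: is_fusion_overlapping.
Qed.

Lemma omega_overlap_reflecting : overlap_reflecting (@omega d P).
Proof. by move=> x y /overlap_omega. Qed.

Lemma OP_fusion_complete : fusion_complete (OP P).
Proof.
move=> F [U0 FU0]; pose A := [set a : P | exists2 U, F U & omega a <= U].
have A0 : A !=set0.
  have [B [b Bb] UB] := OP_ex U0; exists b; exists U0 => //.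
  exact: omega_le_overlapping_set UB Bb.
have AOP : overlapping_set A \in OP_set P by apply/mem_set; exists A.
exists (MkOP AOP); split=> [|V]; first by exists U0.
rewrite (overlap_overlapping_set A) //; split.
  by move=> [a [U FU aU] Va]; exists U => //; exact: overlap_le aU Va.
move=> [U FU]; have [B _ UB] := OP_ex U.
move=> /(overlap_overlapping_set _ _ _ UB)[b Bb Vb]; exists b => //.
by exists U => //; exact: omega_le_overlapping_set UB Bb.
Qed.

Lemma omega_order_embedding : separative P -> order_embedding (@omega d P).
Proof.
move=> sepP x y; split; first exact: omega_homo.
move=> /OP_leP xy; apply: contrapT => /negP /sepP[z zx]; apply.
by apply/overlap_sym/xy; exists z.
Qed.

End Omega.

Theorem proposition4p3 (d : Order.disp_t) (P : porderType d)
    (P_separative : separative P) : fusion_completion (@omega d P).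
Proof.
split; [exact: OP_fusion_complete | exact: omega_order_embedding | | |].
- exact: omega_overlap_reflecting.
- exact: omega_fusion_preserving.
- exact: omega_fusion_dense.
Qed.
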